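(* Suppose $(X,\phi)$ is a calibrated manifold. For each function $f\in C^\infty(X)$, $$\mathcal H^\phi(f)(\xi)\ =\ \mathrm{tr}_\xi(\mathrm{Hess} f)\qquad\text{for all }\xi\in G(\phi).$$
   Context: A calibrated manifold $(X,\phi)$ of degree $p\ge 1$ is a smooth riemannian manifold $X$ together with a closed smooth $p$-form $\phi$ such that $\phi(\xi)\le 1$ for every unit simple tangent $p$-vector $\xi$ on $X$. $G(\phi)$ denotes the set of unit simple tangent $p$-vectors $\xi=e_1\wedge\cdots\wedge e_p$ ($e_i\in T_xX$ orthonormal) with $\phi(\xi)=1$. $\mathrm{Hess} f$ is the symmetric endomorphism $V\mapsto\nabla_V(\nabla f)$ of $TX$ ($\nabla$ the Levi-Civita connection), and the $\phi$-Hessian is the $p$-form $\mathcal H^\phi(f)(v_1,\dots,v_p)=\sum_{i=1}^p\phi(v_1,\dots,\nabla_{v_i}(\nabla f),\dots,v_p)$ (with $\nabla_{v_i}(\nabla f)$ in the $i$-th slot). For an endomorphism $A$ of $T_xX$ and $\xi=e_1\wedge\cdots\wedge e_p$ with $e_1,\dots,e_p$ orthonormal, $\mathrm{tr}_\xi A=\sum_{j=1}^p\langle e_j,Ae_j\rangle$. *)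

(* Defs.v *)
From HB Require Import structures.
From mathcomp Require Import all_boot all_order all_algebra.
From mathcomp Require Import all_classical all_reals topology normedtype derive.
From mathcomp Require Import ring.

Set Implicit Arguments.
Unset Strict Implicit.
Unset Printing Implicit Defensive.

Import Order.TTheory GRing.Theory Num.Theory numFieldNormedType.Exports.

Local Open Scope classical_set_scope.
Local Open Scope ring_scope.

(* Continuous partial derivatives up to order [k]; meant for an open [U]. *)
Fixpoint Ck_on (R : realType) (n k : nat) (U : set 'rV[R]_n) (f : 'rV[R]_n -> R)
    : Prop :=
  (forall x, U x -> {for x, continuous f}) /\
  if k is k'.+1 then
    forall i : 'I_n, (forall x, U x -> derivable f x (delta_mx 0 i)) /\
                     Ck_on k' U ('D_(delta_mx 0 i) f)
  else True.

Definition smooth_on (R : realType) (n : nat) (U : set 'rV[R]_n)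
  (f : 'rV[R]_n -> R) : Prop := forall k, Ck_on k U f.

Section SmoothOn.
Context (R : realType) (n : nat) (U : set 'rV[R]_n) (oU : open U).
Implicit Types f g : 'rV[R]_n -> R.

Lemma near_U f g x : (forall y, U y -> f y = g y) -> U x ->
  \forall y \near x, f y = g y.
Proof.
by move=> fg Ux; apply: filterS (open_nbhs_nbhs (conj oU Ux)) => y; exact: fg.
Qed.

Lemma Ck_on_eq k f g : (forall x, U x -> f x = g x) ->
  Ck_on k U f -> Ck_on k U g.
Proof.
have cont f1 g1 : (forall x, U x -> f1 x = g1 x) ->
    (forall x, U x -> {for x, continuous f1}) ->
    forall x, U x -> {for x, continuous g1}.
  move=> fg cf x Ux; rewrite /prop_for /continuous_at -(fg _ Ux).
  exact: cvg_trans (near_eq_cvg (near_U fg Ux)) (cf x Ux).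
elim: k f g => [|k IH] f g fg /= [cf df]; split=> //; try exact: cont cf.
move=> i; have [d1 d2] := df i; split.
  by move=> x Ux; apply: near_eq_derivable (d1 x Ux); apply: near_U.
by apply: IH d2 => x Ux; apply: near_eq_derive; apply: near_U.
Qed.

Lemma Ck_onW k f : Ck_on k.+1 U f -> Ck_on k U f.
Proof.
elim: k f => [|k IH] f [cf df]; split=> // i.
by have [d1 d2] := df i; split=> //; exact: IH.
Qed.

Lemma Ck_on_cst k (c : R) : Ck_on k U (cst c).
Proof.
elim: k c => [|k IH] c; split=> //; try by move=> x _; exact: cst_continuous.
move=> i; split; first by move=> x _; exact: derivable_cst.
by apply: Ck_on_eq (IH 0) => x _; rewrite derive_cst.
Qed.

Lemma Ck_onD k f g : Ck_on k U f -> Ck_on k U g -> Ck_on k U (f + g).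
Proof.
elim: k f g => [|k IH] f g [cf df] [cg dg]; split=> //;
  try by move=> x Ux; apply: continuousD; [exact: cf|exact: cg].
move=> i; have [f1 f2] := df i; have [g1 g2] := dg i; split.
  by move=> x Ux; apply: derivableD; [exact: f1|exact: g1].
apply: Ck_on_eq (IH _ _ f2 g2) => x Ux.
by rewrite deriveD //; [exact: f1|exact: g1].
Qed.

Lemma Ck_onM k f g : Ck_on k U f -> Ck_on k U g -> Ck_on k U (f * g).
Proof.
elim: k f g => [|k IH] f g.
  move=> [cf _] [cg _]; split=> // x Ux.
  by apply: continuousM; [exact: cf|exact: cg].
move=> Cf Cg; have [cf df] := Cf; have [cg dg] := Cg; split.
  by move=> x Ux; apply: continuousM; [exact: cf|exact: cg].
move=> i; have [f1 f2] := df i; have [g1 g2] := dg i; split.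
  by move=> x Ux; apply: derivableM; [exact: f1|exact: g1].
apply: Ck_on_eq (Ck_onD (IH _ _ (Ck_onW Cf) g2) (IH _ _ (Ck_onW Cg) f2)).
by move=> x Ux; rewrite deriveM //; [exact: f1|exact: g1].
Qed.

End SmoothOn.

(* [chart_inv] is only relevant on [chart_cod] and [chart_map] on [chart_dom]. *)
Record chart (R : realType) (n : nat) (X : topologicalType) := Chart {
  chart_dom : set X;
  chart_cod : set 'rV[R]_n;
  chart_map : X -> 'rV[R]_n;
  chart_inv : 'rV[R]_n -> X;
  chart_dom_open : open chart_dom;
  chart_cod_open : open chart_cod;
  chart_mapP : forall x, chart_dom x -> chart_cod (chart_map x);
  chart_invP : forall y, chart_cod y -> chart_dom (chart_inv y);
  chart_mapK : forall x, chart_dom x -> chart_inv (chart_map x) = x;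
  chart_invK : forall y, chart_cod y -> chart_map (chart_inv y) = y;
  chart_map_continuous :
    forall x, chart_dom x -> {for x, continuous chart_map};
  chart_inv_continuous :
    forall y, chart_cod y -> {for y, continuous chart_inv} }.

Arguments chart_dom_open {R n X} c.
Arguments chart_cod_open {R n X} c.

Definition smooth_transition (R : realType) (n : nat) (X : topologicalType)
    (c d : chart R n X) : Prop :=
  forall i : 'I_n,
    smooth_on (chart_cod c `&` chart_inv c @^-1` chart_dom d)
              (fun y => chart_map d (chart_inv c y) 0 i).

Record manifold (R : realType) (n : nat) := Manifold {
  manifold_space :> topologicalType;
  manifold_hausdorff : hausdorff_space manifold_space;
  manifold_countable : @second_countable manifold_space;
  atlas : set (chart R n manifold_space);
  atlas_cover : forall x, exists2 c, atlas c & chart_dom c x;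
  atlas_compat : forall c d, atlas c -> atlas d -> smooth_transition c d }.

Definition smooth (R : realType) (n : nat) (X : manifold R n) (f : X -> R)
    : Prop :=
  forall c, atlas c -> smooth_on (chart_cod c) (f \o chart_inv c).

Definition smooth_pred (R : realType) (n : nat) (X : manifold R n)
    : {pred X -> R^o} := [pred f : X -> R | `[< smooth f >]].
Arguments smooth_pred {R n} X.

(* C^oo(X) *)
Record smooth_fun (R : realType) (n : nat) (X : manifold R n) := SmoothFun {
  smooth_fun_val :> X -> R^o;
  smooth_funP : smooth_fun_val \in smooth_pred X }.

Section SmoothFunAlgebra.
Context (R : realType) (n : nat) (X : manifold R n).

HB.instance Definition _ := [isSub for @smooth_fun_val R n X].
HB.instance Definition _ := [Choice of smooth_fun X by <:].

Lemma smoothD (f g : X -> R) : smooth f -> smooth g -> smooth (f + g).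
Proof.
move=> sf sg c ac k.
exact (Ck_onD (chart_cod_open c) (sf c ac k) (sg c ac k)).
Qed.

Lemma smoothM (f g : X -> R) : smooth f -> smooth g -> smooth (f * g).
Proof.
move=> sf sg c ac k.
exact (Ck_onM (chart_cod_open c) (sf c ac k) (sg c ac k)).
Qed.

Lemma smooth_cst (a : R) : smooth (cst a : X -> R).
Proof. by move=> c ac k; exact: Ck_on_cst (chart_cod_open c) k a. Qed.

Lemma smoothZ (a : R) (f : X -> R) : smooth f -> smooth (fun x => a * f x).
Proof. exact: smoothM (@smooth_cst a). Qed.

Lemma smoothB (f g : X -> R) : smooth f -> smooth g ->
  smooth (fun x => f x - g x).
Proof.
move=> sf sg; have := smoothD sf (smoothZ (-1) sg).
suff -> : f + (fun x => -1 * g x) = (fun x => f x - g x) by [].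
by apply/funext => x; rewrite -[- g x]mulN1r.
Qed.

Lemma smooth_subring_closed : subring_closed (smooth_pred X).
Proof.
split=> [|f g|f g].
- by apply/asboolP; exact: smooth_cst.
- by move=> /asboolP sf /asboolP sg; apply/asboolP; exact: smoothB.
- by move=> /asboolP sf /asboolP sg; apply/asboolP; exact: smoothM.
Qed.

Lemma smooth_submod_closed : submod_closed (smooth_pred X).
Proof.
split=> [|a f g]; first by apply/asboolP; exact: smooth_cst.
move=> /asboolP sf /asboolP sg; apply/asboolP.
exact: smoothD (smoothZ a sf) sg.
Qed.

HB.instance Definition _ := GRing.SubChoice_isSubComPzRing.Build
  (X -> R^o) (smooth_pred X) (smooth_fun X) smooth_subring_closed.
HB.instance Definition _ := GRing.SubZmodule_isSubLmodule.Build R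
  (X -> R^o) (smooth_pred X) (smooth_fun X) smooth_submod_closed.

Definition mk_smooth (f : X -> R) (sf : smooth f) : smooth_fun X :=
  SmoothFun (asboolT sf).

Lemma smooth_funE (f : smooth_fun X) : smooth f.
Proof. exact/asboolP/smooth_funP. Qed.

End SmoothFunAlgebra.

(* Tangent vectors at [x] are the derivations of C^oo(X) at [x]. *)
Definition is_derivation (R : realType) (n : nat) (X : manifold R n) (x : X)
    (D : smooth_fun X -> R) : Prop :=
  (forall (a : R) (f g : smooth_fun X), D (a *: f + g) = a * D f + D g) /\
  (forall f g : smooth_fun X, D (f * g) = f x * D g + g x * D f).

Definition derivation_pred (R : realType) (n : nat) (X : manifold R n) (x : X)
    : {pred smooth_fun X -> R^o} :=
  [pred D : smooth_fun X -> R | `[< is_derivation x D >]].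
Arguments derivation_pred {R n X} x.

Record tangent (R : realType) (n : nat) (X : manifold R n) (x : X) := Tangent {
  tangent_val :> smooth_fun X -> R^o;
  tangentP : tangent_val \in derivation_pred x }.

Section TangentSpace.
Context (R : realType) (n : nat) (X : manifold R n) (x : X).

HB.instance Definition _ := [isSub for @tangent_val R n X x].
HB.instance Definition _ := [Choice of tangent x by <:].

Lemma derivation_submod_closed : submod_closed (derivation_pred x).
Proof.
split=> [|a D E].
  apply/asboolP; split=> [b f g|f g]; first by rewrite mulr0 addr0.
  by rewrite !mulr0 addr0.
move=> /asboolP[Dl DM] /asboolP[El EM]; apply/asboolP.
have E1 h : (a *: D + E) h = a * D h + E h by [].
split=> [b f g|f g]; rewrite !E1.
  by rewrite Dl El !mulrDr (mulrCA a b) -!addrA; congr (_ + _); rewrite addrCA.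
rewrite DM EM !mulrDr (mulrCA a (f x)) (mulrCA a (g x)) -!addrA.
by congr (_ + _); rewrite addrCA.
Qed.

HB.instance Definition _ := GRing.SubChoice_isSubLmodule.Build R
  (smooth_fun X -> R^o) (derivation_pred x) (tangent x)
  derivation_submod_closed.

Lemma tangentE (v : tangent x) : is_derivation x v.
Proof. exact/asboolP/tangentP. Qed.

End TangentSpace.

Record vector_field (R : realType) (n : nat) (X : manifold R n) :=
  VectorField {
    vector_field_val :> forall x : X, tangent x;
    vector_field_smooth :
      forall f : smooth_fun X, smooth (fun x => vector_field_val x f) }.

Section VectorFields.
Context (R : realType) (n : nat) (X : manifold R n).
Implicit Types (V W : vector_field X) (f h : smooth_fun X).

Definition vf_apply V f : smooth_fun X := mk_smooth (vector_field_smooth V f).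

Lemma vf_add_smooth V W f : smooth (fun x => (V x + W x) f).
Proof. exact: smoothD (vector_field_smooth V f) (vector_field_smooth W f). Qed.

Definition vf_add V W : vector_field X := VectorField (vf_add_smooth V W).

Lemma vf_scale_smooth h V f : smooth (fun x => (h x *: V x) f).
Proof. exact: smoothM (smooth_funE h) (vector_field_smooth V f). Qed.

Definition vf_scale h V : vector_field X := VectorField (vf_scale_smooth h V).

Definition bracket_at V W (x : X) f : R^o :=
  V x (vf_apply W f) - W x (vf_apply V f).

Lemma bracket_atP V W x : bracket_at V W x \in derivation_pred x.
Proof.
have appL U a f g : vf_apply U (a *: f + g) = a *: vf_apply U f + vf_apply U g.
  by apply/val_inj/funext => y; rewrite /= (tangentE (U y)).1.
have appM U f g : vf_apply U (f * g) = f * vf_apply U g + g * vf_apply U f.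
  by apply/val_inj/funext => y; rewrite /= (tangentE (U y)).2.
have D (v : tangent x) f g : v (f + g) = v f + v g.
  by rewrite -[f]scale1r (tangentE v).1 scale1r mul1r.
apply/asboolP; split=> [a f g|f g]; rewrite /bracket_at.
  by rewrite !appL !(tangentE _).1 mulrBr opprD addrACA.
rewrite !appM !D !(tangentE _).2 /=.
move: (V x (vf_apply W g)) (V x (vf_apply W f)) (W x (vf_apply V g)).
move: (W x (vf_apply V f)) (V x f) (V x g) (W x f) (W x g) (f x) (g x).
rewrite /GRing.regular => a b c d e r s t u v.
ring.
Qed.

Definition bracket_vec V W (x : X) : tangent x := Tangent (bracket_atP V W x).

Lemma bracket_smooth V W f : smooth (fun x => bracket_vec V W x f).
Proof.
exact: smoothB (vector_field_smooth V (vf_apply W f))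
               (vector_field_smooth W (vf_apply V f)).
Qed.

Definition bracket V W : vector_field X := VectorField (bracket_smooth V W).

End VectorFields.

Record riemannian_metric (R : realType) (n : nat) (X : manifold R n) :=
  RiemannianMetric {
    metric :> forall x : X, tangent x -> tangent x -> R;
    metric_sym : forall x (u v : tangent x), metric u v = metric v u;
    metric_linear : forall x (a : R) (u v w : tangent x),
      metric (a *: u + v) w = a * metric u w + metric v w;
    metric_pos : forall x (v : tangent x), v != 0 -> 0 < metric v v;
    metric_smooth : forall V W : vector_field X,
      smooth (fun x => metric (V x) (W x)) }.

Definition metric_apply (R : realType) (n : nat) (X : manifold R n)
    (g : riemannian_metric X) (V W : vector_field X) : smooth_fun X :=
  mk_smooth (metric_smooth g V W).

(* [nabla x v W] is the covariant derivative of [W] in the direction [v];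
   R-linearity in [W] is the Leibniz rule for constant functions. *)
Record connection (R : realType) (n : nat) (X : manifold R n) := Connection {
  nabla :> forall x : X, tangent x -> vector_field X -> tangent x;
  nabla_linear : forall x (a : R) (u v : tangent x) (W : vector_field X),
    nabla (a *: u + v) W = a *: nabla u W + nabla v W;
  nabla_add : forall x (v : tangent x) (W Z : vector_field X),
    nabla v (vf_add W Z) = nabla v W + nabla v Z;
  nabla_leibniz : forall x (v : tangent x) (h : smooth_fun X)
      (W : vector_field X),
    nabla v (vf_scale h W) = v h *: W x + h x *: nabla v W;
  nabla_smooth : forall (V W : vector_field X) (f : smooth_fun X),
    smooth (fun x => nabla (V x) W f) }.

Definition torsion_free (R : realType) (n : nat) (X : manifold R n)
    (D : connection X) : Prop :=
  forall (V W : vector_field X) (x : X),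
    D x (V x) W - D x (W x) V = bracket V W x.

Definition metric_compatible (R : realType) (n : nat) (X : manifold R n)
    (g : riemannian_metric X) (D : connection X) : Prop :=
  forall (x : X) (v : tangent x) (W Z : vector_field X),
    v (metric_apply g W Z) = g x (D x v W) (Z x) + g x (W x) (D x v Z).

Definition is_levi_civita (R : realType) (n : nat) (X : manifold R n)
    (g : riemannian_metric X) (D : connection X) : Prop :=
  torsion_free D /\ metric_compatible g D.

Definition is_gradient (R : realType) (n : nat) (X : manifold R n)
    (g : riemannian_metric X) (f : smooth_fun X) (W : vector_field X) : Prop :=
  forall (x : X) (v : tangent x), g x (W x) v = v f.

Record pform (R : realType) (n p : nat) (X : manifold R n) := PForm {
  pform_val :> forall x : X, ('I_p -> tangent x) -> R;
  pform_linear : forall x (e : 'I_p -> tangent x) (i : 'I_p) (a : R)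
      (u v : tangent x),
    pform_val (dfwith e i (a *: u + v)) =
      a * pform_val (dfwith e i u) + pform_val (dfwith e i v);
  pform_alternating : forall x (e : 'I_p -> tangent x) (i j : 'I_p),
    i != j -> e i = e j -> pform_val e = 0;
  pform_smooth : forall V : 'I_p -> vector_field X,
    smooth (fun x => pform_val (fun k => V k x)) }.

Definition pform_apply (R : realType) (n p : nat) (X : manifold R n)
    (phi : pform p X) (V : 'I_p -> vector_field X) : smooth_fun X :=
  mk_smooth (pform_smooth phi V).

(* Cartan's formula for d phi (V_0, ..., V_p). The usual bracket term
     (-1)^(i + m) phi ([V_i, V_m], V_0, ..., ^V_i, ..., ^V_m, ..., V_p), i < m,
   is written as
     - (-1)^i phi (V_0, ..., ^V_i, ..., [V_i, V_m], ..., V_p)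
   with the bracket moved to the place of V_m; here m = lift i j = j.+1. *)
Definition exterior_derivative (R : realType) (n p : nat) (X : manifold R n)
    (phi : pform p X) (V : 'I_p.+1 -> vector_field X) (x : X) : R :=
  \sum_(i < p.+1) (-1) ^+ i *
    (V i x (pform_apply phi (fun k => V (lift i k))) -
     \sum_(j < p | (i <= j)%N)
       pform_apply phi
         (dfwith (fun k => V (lift i k)) j (bracket (V i) (V (lift i j)))) x).

Definition closed_form (R : realType) (n p : nat) (X : manifold R n)
    (phi : pform p X) : Prop :=
  forall (V : 'I_p.+1 -> vector_field X) (x : X),
    exterior_derivative phi V x = 0.

Definition orthonormal (R : realType) (n p : nat) (X : manifold R n)
    (g : riemannian_metric X) (x : X) (e : 'I_p -> tangent x) : Prop :=
  forall i j : 'I_p, g x (e i) (e j) = (i == j)%:R.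

(* A unit simple p-vector e_1 /\ ... /\ e_p is given by an orthonormal frame. *)
Definition is_calibration (R : realType) (n p : nat) (X : manifold R n)
    (g : riemannian_metric X) (phi : pform p X) : Prop :=
  closed_form phi /\
  forall (x : X) (e : 'I_p -> tangent x), orthonormal g e -> phi x e <= 1.

(* e_1 /\ ... /\ e_p belongs to G(phi) *)
Definition calibrated_frame (R : realType) (n p : nat) (X : manifold R n)
    (g : riemannian_metric X) (phi : pform p X) (x : X)
    (e : 'I_p -> tangent x) : Prop :=
  orthonormal g e /\ phi x e = 1.

(* Hess f at [x], where [gradf] is the gradient of f *)
Definition hess (R : realType) (n : nat) (X : manifold R n) (D : connection X)
    (gradf : vector_field X) (x : X) (v : tangent x) : tangent x :=
  D x v gradf.

Definition phi_hessian (R : realType) (n p : nat) (X : manifold R n)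
    (phi : pform p X) (D : connection X) (gradf : vector_field X) (x : X)
    (v : 'I_p -> tangent x) : R :=
  \sum_(i < p) phi x (dfwith v i (D x (v i) gradf)).

Definition trace_on (R : realType) (n p : nat) (X : manifold R n)
    (g : riemannian_metric X) (x : X) (e : 'I_p -> tangent x)
    (A : tangent x -> tangent x) : R :=
  \sum_(j < p) g x (e j) (A (e j)).

(* Main.v *)
Require Import Defs.
From HB Require Import structures.
From mathcomp Require Import all_boot all_order all_algebra.
From mathcomp Require Import all_classical all_reals topology normedtype derive.
From mathcomp Require Import ring lra.

(** The identity is pointwise: it holds at [x] with [Hess f] replaced by any
    endomorphism of the tangent space, and it is then proved one slot at a
    time, in the form

      [phi (e_1, ..., u, ..., e_p) = <e_i, u>]   ([u] in the slot [i])

    for every calibrated frame [e] and every tangent vector [u].  Split [u] into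
    its component [<e_i, u> e_i], its components along the other [e_j], and a
    remainder [w] orthogonal to the whole frame.  The first component
    contributes [<e_i, u> phi(e) = <e_i, u>], and the components along the other
    [e_j] contribute zero because [phi] is alternating.  The remainder also
    contributes zero, by the first cousin principle
    ([calibrated_frame_first_cousin]): rotating [e_i] towards [w] keeps the
    frame orthonormal, so the value of [phi] is bounded by [1] along the
    rotation; this maximum is attained at [e], hence the first variation
    [phi (e_1, ..., w, ..., e_p)] vanishes. *)

Import Order.TTheory GRing.Theory Num.Theory.

Local Open Scope ring_scope.

Section MetricAlgebra.
Context {R : realType} {n : nat} {X : manifold R n} (g : riemannian_metric X).
Context {x : X}.
Implicit Types u v w : tangent x.

Definition metricl w : tangent x -> R^o := fun u => g x u w.

Lemma metricl_is_linear w : linear (metricl w).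
Proof. by move=> a u v; exact: Defs.metric_linear. Qed.

HB.instance Definition _ w :=
  GRing.isLinear.Build R (tangent x) R^o _ (metricl w) (metricl_is_linear w).

Lemma metricDl u v w : g x (u + v) w = g x u w + g x v w.
Proof. exact: (raddfD (metricl w)). Qed.

Lemma metricBl u v w : g x (u - v) w = g x u w - g x v w.
Proof. exact: (raddfB (metricl w)). Qed.

Lemma metricZl a u w : g x (a *: u) w = a * g x u w.
Proof. exact: (linearZ_LR (metricl w)). Qed.

Lemma metricDr u v w : g x u (v + w) = g x u v + g x u w.
Proof. by rewrite !(Defs.metric_sym g u) metricDl. Qed.

Lemma metricZr a u w : g x u (a *: w) = a * g x u w.
Proof. by rewrite !(Defs.metric_sym g u) metricZl. Qed.

Lemma metric_suml (I : finType) (F : I -> tangent x) w :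
  g x (\sum_i F i) w = \sum_i g x (F i) w.
Proof. exact: (raddf_sum (metricl w)). Qed.

End MetricAlgebra.

Section PFormSlot.
Context {R : realType} {n p : nat} {X : manifold R n} (phi : pform p X).
Context {x : X} (e : 'I_p -> tangent x).

Definition pform_slot (i : 'I_p) : tangent x -> R^o :=
  fun u => phi x (dfwith e i u).

Lemma pform_slot_is_linear i : linear (pform_slot i).
Proof. by move=> a u v; exact: pform_linear. Qed.

HB.instance Definition _ i :=
  GRing.isLinear.Build R (tangent x) R^o _ (pform_slot i)
    (pform_slot_is_linear i).

Lemma pform_slotZ i a u : pform_slot i (a *: u) = a * pform_slot i u.
Proof. exact: (linearZ_LR (pform_slot i)). Qed.

Lemma pform_slot_frame i j : pform_slot i (e j) = (i == j)%:R * phi x e.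
Proof.
rewrite /pform_slot; have [<-|ij] := eqVneq i j.
  rewrite mul1r; congr (phi x _); apply/funext => k.
  by case: dfwithP.
rewrite mul0r; apply: (pform_alternating _ ij).
by rewrite dfwithin dfwithout.
Qed.

End PFormSlot.

Lemma orthonormal_dfwith {R : realType} {n p : nat} {X : manifold R n}
    (g : riemannian_metric X) (x : X) (e : 'I_p -> tangent x) (i : 'I_p)
    (u : tangent x) :
  Defs.orthonormal g e -> g x u u = 1 ->
  (forall j, j != i -> g x u (e j) = 0) ->
  Defs.orthonormal g (dfwith e i u).
Proof.
move=> oe uu ue j k.
have [->|ji] := eqVneq j i; have [->|ki] := eqVneq k i.
- by rewrite dfwithin uu.
- rewrite dfwithin dfwithout; last by rewrite eq_sym.
  by rewrite ue// eq_sym (negbTE ki).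
- rewrite dfwithin dfwithout; last by rewrite eq_sym.
  by rewrite Defs.metric_sym ue// (negbTE ji).
- by rewrite !dfwithout ?oe// eq_sym.
Qed.

Section FirstCousin.
Context {R : realType} {n p : nat} {X : manifold R n}.
Context (g : riemannian_metric X) (phi : pform p X) {x : X}.
Context (e : 'I_p -> tangent x).
Hypothesis comass1 :
  forall e' : 'I_p -> tangent x, Defs.orthonormal g e' -> phi x e' <= 1.
Hypothesis calib : calibrated_frame g phi e.

(** For [w != 0] and [a = phi (e_1, ..., w, ..., e_p)], the frame obtained by
    replacing [e_i] with the normalization of [e_i + s w] gives
    [1 + s a <= sqrt (1 + s^2 |w|^2)] for all [s].  No derivative is needed: the
    single value [s = a / |w|^2] gives [1 + b <= sqrt (1 + b)] for
    [b = a^2 / |w|^2 >= 0], which forces [b = 0]. *)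
Lemma calibrated_frame_first_cousin i (w : tangent x) :
  (forall j, g x w (e j) = 0) -> phi x (dfwith e i w) = 0.
Proof.
case: calib => oe phie we; rewrite -/(pform_slot phi e i w).
have [->|w0] := eqVneq w 0; first by rewrite raddf0.
set a : R := pform_slot phi e i w.
have q0 := Defs.metric_pos g w0; set q := g x w w in q0.
have b0 : 0 <= a ^+ 2 / q by rewrite divr_ge0 ?sqr_ge0// ltW.
set b : R := a ^+ 2 / q in b0.
set r : R := Num.sqrt (1 + b).
have r0 : 0 < r by rewrite sqrtr_gt0; lra.
have r2 : r ^+ 2 = 1 + b by rewrite sqr_sqrtr//; lra.
pose v := e i + (a / q) *: w.
have vv : g x v v = r ^+ 2.
  rewrite r2 /v !(metricDl, metricDr, metricZl, metricZr) we.
  rewrite (Defs.metric_sym g (e i) w) we oe eqxx -/q /b /=.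
  by field; rewrite gt_eqF.
have phiv : pform_slot phi e i v = r ^+ 2.
  rewrite r2 /v raddfD /= pform_slotZ pform_slot_frame eqxx mul1r phie -/a.
  by rewrite /b expr2 mulrAC.
have ov : Defs.orthonormal g (dfwith e i (r^-1 *: v)).
  apply: orthonormal_dfwith => // [|j ji].
    by rewrite metricZl metricZr vv expr2 mulKf ?mulVf ?gt_eqF.
  rewrite metricZl metricDl metricZl we oe eq_sym (negbTE ji).
  by rewrite mulr0 addr0 mulr0.
have := comass1 _ ov; rewrite -/(pform_slot phi e i _) pform_slotZ phiv.
rewrite expr2 mulKf ?gt_eqF// => r1.
have /eqP : b = 0 by apply/eqP; rewrite eq_le b0 andbT; nra.
by rewrite mulf_eq0 invr_eq0 (gt_eqF q0) orbF sqrf_eq0 => /eqP.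
Qed.

(** On the span of the frame this is alternation together with [phi(e) = 1];
    on its orthogonal complement both sides vanish, the left one by the first
    cousin principle. *)
Lemma calibrated_frame_slot i (u : tangent x) :
  phi x (dfwith e i u) = g x (e i) u.
Proof.
have [oe phie] := calib.
(* [t] is the orthogonal projection of [u] to the span of the frame. *)
pose t := \sum_j g x u (e j) *: e j.
have -> : phi x (dfwith e i u) = pform_slot phi e i ((u - t) + t).
  by rewrite subrK.
have /calibrated_frame_first_cousin-/(_ i) : forall k, g x (u - t) (e k) = 0.
  move=> k; rewrite metricBl metric_suml (bigD1 k)//= metricZl oe eqxx mulr1.
  rewrite big1 ?addr0 ?subrr// => j jk.
  by rewrite metricZl oe (negbTE jk) mulr0.
rewrite raddfD /= -/(pform_slot phi e i _) => ->; rewrite add0r raddf_sum.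
rewrite (bigD1 i)//= pform_slotZ pform_slot_frame phie eqxx big1 => [|j ji].
  by rewrite addr0 mulr1 Defs.metric_sym mulr1.
by rewrite pform_slotZ pform_slot_frame eq_sym (negbTE ji) mul0r mulr0.
Qed.

End FirstCousin.

Theorem corollary2p5 (R : realType) (n p : nat) (p_ge1 : (1 <= p)%N)
    (X : manifold R n) (g : riemannian_metric X) (phi : pform p X)
    (phi_calibration : is_calibration g phi)
    (D : connection X) (D_levi_civita : is_levi_civita g D)
    (f : smooth_fun X) (gradf : vector_field X)
    (gradf_gradient : is_gradient g f gradf)
    (x : X) (xi : 'I_p -> tangent x) :
  calibrated_frame g phi xi ->
  phi_hessian phi D gradf xi = trace_on g xi (hess D gradf (x := x)).
Proof.
move=> calib; apply: eq_bigr => i _.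
exact: calibrated_frame_slot (phi_calibration.2 x) calib i _.
Qed.
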